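(* Let $m, n \geq 1$ be integers. Equivalence up to scale is an equivalence relation (that is, it is reflexive, symmetric and transitive) on the set of real $m \times n$ matrices.
   Context: For a vector $x$, $D_x$ denotes the square diagonal matrix with diagonal entries $d_{ii} = x_i$. Two real $m \times n$ matrices $A$ and $B$ are called equivalent up to scale if there exist strictly positive vectors (all entries $> 0$) $p \in \mathbb{R}^n$ and $q \in \mathbb{R}^m$ such that $D_q B = A D_p$. *)

(* Defs.v *)
(* MathComp world; the real numbers are an arbitrary [R : realType]. *)
From mathcomp Require Import all_boot all_order all_algebra.
From mathcomp Require Import reals.

Set Implicit Arguments.
Unset Strict Implicit.
Unset Printing Implicit Defensive.

Import Order.TTheory GRing.Theory Num.Theory.
Local Open Scope ring_scope.

Definition strictly_positive (R : realType) (n : nat) (x : 'rV[R]_n) : Prop :=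
  forall i : 'I_n, 0 < x 0 i.

(* D_x is [diag_mx x]; MathComp takes the diagonal as a row vector. *)
Definition equivalent_up_to_scale (R : realType) (m n : nat)
    (A B : 'M[R]_(m, n)) : Prop :=
  exists (p : 'rV[R]_n) (q : 'rV[R]_m),
    [/\ strictly_positive p, strictly_positive q
      & diag_mx q *m B = A *m diag_mx p].

(* Main.v *)
Require Import Defs.
From Stdlib Require Import RelationClasses.
From mathcomp Require Import all_boot all_order all_algebra.
From mathcomp Require Import reals.

Import Order.TTheory GRing.Theory Num.Theory.
Local Open Scope ring_scope.

(** Read entrywise, the relation says [q_i * B i j = A i j * p_j]: [B] arises from [A] by positive
    row and column rescalings. The pairs [(p, q)] of positive vectors form a group under entrywise
    product; its unit, inverses and products give reflexivity, symmetry and transitivity.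
    [equivalent_up_to_scaleP] reduces each case to scalar algebra. *)

Lemma equivalent_up_to_scaleP (R : realType) (m n : nat) (A B : 'M[R]_(m, n)) :
  equivalent_up_to_scale A B <->
  exists (p : 'rV[R]_n) (q : 'rV[R]_m),
    [/\ strictly_positive p, strictly_positive q
      & forall i j, q 0 i * B i j = A i j * p 0 j].
Proof.
split=> -[p [q [p_gt0 q_gt0 eqAB]]]; exists p, q; split=> //.
  by move=> i j; move/matrixP/(_ i j): eqAB; rewrite mul_diag_mx mul_mx_diag !mxE.
by apply/matrixP => i j; rewrite mul_diag_mx mul_mx_diag !mxE.
Qed.

Lemma equivalent_up_to_scale_refl (R : realType) (m n : nat) (A : 'M[R]_(m, n)) :
  equivalent_up_to_scale A A.
Proof.
apply/equivalent_up_to_scaleP; exists (const_mx 1), (const_mx 1).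
by split=> [i|i|i j]; rewrite !mxE ?ltr01 // mul1r mulr1.
Qed.

Lemma equivalent_up_to_scale_sym (R : realType) (m n : nat) (A B : 'M[R]_(m, n)) :
  equivalent_up_to_scale A B -> equivalent_up_to_scale B A.
Proof.
move=> /equivalent_up_to_scaleP[p [q [p_gt0 q_gt0 eqAB]]].
apply/equivalent_up_to_scaleP.
exists (map_mx GRing.inv p), (map_mx GRing.inv q).
split=> [i|i|i j]; rewrite !mxE ?invr_gt0 //.
(* Multiplying by the nonzero [q_i] leaves [A i j = q_i * (B i j / p_j)], where the hypothesis turns
   [q_i * B i j] into [A i j * p_j] and [p_j] cancels. *)
apply: (mulfI (lt0r_neq0 (q_gt0 i))); rewrite mulVKf ?lt0r_neq0 //.
by rewrite mulrA eqAB mulfK ?lt0r_neq0.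
Qed.

Lemma equivalent_up_to_scale_trans (R : realType) (m n : nat)
    (A B C : 'M[R]_(m, n)) :
  equivalent_up_to_scale A B -> equivalent_up_to_scale B C ->
  equivalent_up_to_scale A C.
Proof.
move=> /equivalent_up_to_scaleP[p [q [p_gt0 q_gt0 eqAB]]].
move=> /equivalent_up_to_scaleP[p' [q' [p'_gt0 q'_gt0 eqBC]]].
apply/equivalent_up_to_scaleP.
exists (\row_j (p 0 j * p' 0 j)), (\row_i (q 0 i * q' 0 i)).
split=> [i|i|i j]; rewrite !mxE ?mulr_gt0 //.
(* [q_i * (q'_i * C i j) = (q_i * B i j) * p'_j = A i j * p_j * p'_j]: the inner factor [q'_i] is
   absorbed first, then [q_i]. *)
by rewrite -mulrA eqBC mulrA eqAB mulrA.
Qed.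

Theorem lemma1 (R : realType) (m n : nat) (hm : (1 <= m)%N) (hn : (1 <= n)%N) :
  Equivalence (@equivalent_up_to_scale R m n).
Proof.
split.
- exact: equivalent_up_to_scale_refl.
- exact: equivalent_up_to_scale_sym.
- exact: equivalent_up_to_scale_trans.
Qed.
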